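(* Let $\Gamma=(X,R)$ be a connected graph (not necessarily regular) with Laplacian matrix $L$, $d+1$ distinct Laplacian eigenvalues, diameter $D$, and Laplacian predistance polynomials $r_0,r_1,\ldots,r_d$. Let $s_{D-1}=r_0+r_1+\cdots+r_{D-1}$. Then $$ \frac{|X|}{\sum_{x\in X}\frac{1}{|X|-|\Gamma_D(x)|}}\ \ge\ s_{D-1}(0)=|X|-\sum_{i=D}^d r_i(0), $$ and equality holds in the inequality if and only if $A_D=\sum_{i=D}^d r_i(L)$. Moreover, in the case of equality, if $D=2$ then $\Gamma$ is regular.
   Context: Graphs are finite, simple, undirected, connected, with vertex set $X$, $n=|X|\ge 2$. For $x\in X$, $\Gamma_i(x)$ is the set of vertices at distance exactly $i$ from $x$. $D$ is the diameter, and $A_D$ is the $X\times X$ distance-$D$ matrix: $(A_D)_{xy}=1$ if $x,y$ are at distance $D$, and $0$ otherwise. The Laplacian matrix is $L=K-A$, where $A$ is the adjacency matrix and $K$ is the diagonal matrix of vertex degrees. Let $\theta_0=0<\theta_1<\cdots<\theta_d$ be the distinct eigenvalues of $L$, with multiplicities $m(\theta_i)$. On the real polynomials of degree at most $d$ consider the scalar product $$\langle f,g\rangle_L=\frac1n\operatorname{tr}(f(L)g(L))=\frac1n\sum_{i=0}^d m(\theta_i)f(\theta_i)g(\theta_i).$$ The Laplacian predistance polynomials $r_0,\ldots,r_d$ are the unique sequence of polynomials with $\deg r_i=i$, pairwise orthogonal for $\langle\cdot,\cdot\rangle_L$, normalized so that $\|r_i\|_L^2=\langle r_i,r_i\rangle_L=r_i(0)$.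 *)

(* Defs.v *)
From HB Require Import structures.
From mathcomp Require Import all_boot all_order all_algebra.

Set Implicit Arguments.
Unset Strict Implicit.
Unset Printing Implicit Defensive.

Import Order.TTheory GRing.Theory Num.Theory.
Local Open Scope ring_scope.

Section GraphDistance.
Variables (X : finType) (e : rel X).

Definition simple_graph : Prop := symmetric e /\ irreflexive e.

Definition connected_graph : Prop := forall x y, connect e x y.

Definition walk (k : nat) (x y : X) : bool :=
  [exists p : k.-tuple X, path e x p && (last x p == y)].

(* Shortest walk length; the search range suffices because shortest paths
   visit each vertex at most once. The value is #|X| when y is not reachable
   from x, which does not occur in a connected graph. *)
Definition gdist (x y : X) : nat := find (fun k => walk k x y) (iota 0 #|X|).

Definition sphere (i : nat) (x : X) : {set X} := [set y | gdist x y == i].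

Definition diameter : nat := \max_(x : X) \max_(y : X) gdist x y.

Definition degree (x : X) : nat := #|[set y | e x y]|.

Definition regular_graph : Prop := exists k, forall x, degree x = k.

Lemma walkP k x y :
  reflect (exists p, [/\ path e x p, last x p = y & size p = k]) (walk k x y).
Proof.
apply: (iffP existsP) => [[p /andP[pp /eqP lp]]|[p [pp lp /eqP sp]]].
  by exists p; split=> //; exact: size_tuple.
by exists (Tuple sp); rewrite /= pp lp eqxx.
Qed.

Lemma gdist_le x p : path e x p -> (gdist x (last x p) <= size p)%N.
Proof.
move=> pp; have [q pq uq sq] := shortenP pp.
have wq : walk (size q) x (last x q) by apply/walkP; exists q.
have qX : (size q < #|X|)%N by have := max_card (mem (x :: q)); rewrite (card_uniqP uq).
have/leq_trans -> // : (gdist x (last x q) <= size q)%N; last first.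
  by rewrite uniq_leq_size //; case/andP: uq.
rewrite leqNgt; apply/negP => /(before_find 0%N).
by rewrite nth_iota // add0n wq.
Qed.

Lemma walk_gdist x y : connect e x y -> walk (gdist x y) x y.
Proof.
move=> /connectP[p pp ->]; have [q pq uq sq] := shortenP pp.
have qX : (size q < #|X|)%N by have := max_card (mem (x :: q)); rewrite (card_uniqP uq).
have lt : (gdist x (last x q) < #|X|)%N by apply: leq_ltn_trans (gdist_le pq) qX.
have : has (fun k => walk k x (last x q)) (iota 0 #|X|) by rewrite has_find size_iota.
move=> /(nth_find 0%N) /=; rewrite -/(gdist x (last x q)).
by rewrite nth_iota // add0n.
Qed.

End GraphDistance.

Section GraphMatrices.
Variables (R : rcfType) (X : finType) (e : rel X).

(* X x X matrices are indexed through the enumeration enum_val : 'I_#|X| -> X. *)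
Definition graph_mx (f : X -> X -> R) : 'M[R]_#|X| :=
  \matrix_(i, j) f (enum_val i) (enum_val j).

Definition adjacency_mx : 'M[R]_#|X| := graph_mx (fun x y => (e x y)%:R).

Definition degree_mx : 'M[R]_#|X| :=
  graph_mx (fun x y => if x == y then (degree e x)%:R else 0).

Definition laplacian_mx : 'M[R]_#|X| := degree_mx - adjacency_mx.

Definition distance_mx (i : nat) : 'M[R]_#|X| :=
  graph_mx (fun x y => (gdist e x y == i)%:R).

End GraphMatrices.

(* horner_mx for square matrices whose size is not syntactically a successor. *)
Definition mxeval (R : comNzRingType) (n : nat) (A : 'M[R]_n) (p : {poly R}) :
  'M[R]_n := \sum_(i < size p) p`_i *: A ^+ i.

Lemma mxevalE (R : comNzRingType) (n : nat) (A : 'M[R]_n.+1) (p : {poly R}) :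
  mxeval A p = horner_mx A p.
Proof.
rewrite -{2}[p]coefK poly_def rmorph_sum /=; apply: eq_bigr => i _.
by rewrite linearZ /= rmorphXn /= horner_mx_X.
Qed.

Section Predistance.
Variables (R : rcfType) (X : finType) (e : rel X).

Let L : 'M[R]_#|X| := laplacian_mx R e.

(* th lists the distinct eigenvalues of L in increasing order. *)
Definition laplacian_spectrum (th : seq R) : Prop :=
  sorted <%R th /\ th =i eigenvalue L.

Definition lap_dot (f g : {poly R}) : R :=
  #|X|%:R^-1 * \tr (mxeval L f *m mxeval L g).

Definition laplacian_predistance (d : nat) (r : nat -> {poly R}) : Prop :=
  [/\ forall i, (i <= d)%N -> size (r i) = i.+1,
      forall i j, (i <= d)%N -> (j <= d)%N -> i != j ->
        lap_dot (r i) (r j) = 0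
    & forall i, (i <= d)%N -> lap_dot (r i) (r i) = (r i).[0]].

End Predistance.

(* Main.v *)
Require Import Defs.
From HB Require Import structures.
From mathcomp Require Import all_boot all_order all_algebra.
From mathcomp Require Import spectral sesquilinear complex.
From mathcomp Require Import ring.

Set Implicit Arguments.
Unset Strict Implicit.
Unset Printing Implicit Defensive.

Import Order.TTheory GRing.Theory Num.Theory.
Local Open Scope ring_scope.

(** The proof compares, row by row, the matrix [s(L)] with the pattern of its
    nonzero entries, where [s = r_0 + ... + r_(D-1)].

    Three facts about [M = s(L)] drive everything.  A polynomial of degree less
    than [k] in [L] vanishes at every pair of vertices at distance at least [k]
    ([mxeval_laplacian_far]), so row [x] of [M] lives on the
    [n - |Gamma_D(x)|] vertices outside [Gamma_D(x)].  Rows of [L] sum to zero,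
    so every row of [M] sums to [s(0)] ([mxeval_laplacian_const]).  Finally
    [M] is symmetric and orthogonality with the normalization
    [<r_i, r_i> = r_i(0)] gives [<s, s> = s(0)], that is, the squares of all
    entries of [M] add up to [n s(0)] ([lap_dot_partial_sum_self]).
    Cauchy-Schwarz on each row, [s(0)^2 <= (n - |Gamma_D(x)|) sum_y M_xy^2],
    summed over [x], is the inequality.  Here Cauchy-Schwarz is used as an
    exact identity with a sum of squares as defect ([sum_sqr_dev]), so the
    equality case comes for free: equality holds exactly when each row of [M]
    is constant on its allowed support ([harmonic_mean_eq]).

    The Hoffman polynomial links this to the remaining [r_i].  As [L] is real
    symmetric, [prod_i (X - theta_i)] annihilates it
    ([symmetric_mxeval_roots], through the complex spectral theorem); removing
    the factor [X] leaves a polynomial whose value at [L] has all its columns in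
    the kernel of [L], the constant vectors, hence is a nonzero multiple of the
    all-one matrix [J] ([laplacian_hoffman]).  Since [<h, f> = f(0)] when
    [h(L) = J], and [r_0 + ... + r_d] reproduces the value at [0] on each [r_j]
    as well, the two agree at [L] ([predistance_sum_hoffman]).  Hence
    [sum_(i >= D) r_i(L) = J - M], evaluation at [0] gives the formula for
    [s(0)], and [A_D = sum_(i >= D) r_i(L)] says that [M] has all entries [1] at
    distance less than [D].  To get this from equality, note that the constant
    of row [x] is [M_xx]; by symmetry it is the same at adjacent vertices when
    [D >= 2], so the diagonal of [M] is constant, and it is [1] because
    [tr M = n <s, r_0> = n] ([equality_entries]).  When [D = 2], the diagonal of
    [M = I + a L + b I] being constant forces constant degree. *)

(** * Evaluating polynomials at a square matrix *)

Section MxEval.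
Variables (R : comNzRingType) (n : nat) (A : 'M[R]_n).
Implicit Types p q : {poly R}.

Lemma mxevalZD c p q : mxeval A (c *: p + q) = c *: mxeval A p + mxeval A q.
Proof.
case: n A => [B|m B]; first by rewrite [LHS]flatmx0 [RHS]flatmx0.
by rewrite !mxevalE linearP.
Qed.

Lemma mxevalM p q : mxeval A (p * q) = mxeval A p *m mxeval A q.
Proof.
case: n A => [B|m B]; first by rewrite [LHS]flatmx0 [RHS]flatmx0.
by rewrite !mxevalE rmorphM.
Qed.

Lemma mxevalX : mxeval A 'X = A.
Proof.
case: n A => [B|m B]; first by rewrite [LHS]flatmx0 [RHS]flatmx0.
by rewrite !mxevalE horner_mx_X.
Qed.

Lemma mxevalC c : mxeval A c%:P = c%:M.
Proof.
case: n A => [B|m B]; first by rewrite [LHS]flatmx0 [RHS]flatmx0.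
by rewrite !mxevalE horner_mx_C.
Qed.

Lemma mxeval0 : mxeval A 0 = 0.
Proof. by rewrite -[0 in LHS]polyC0 mxevalC raddf0. Qed.

Lemma mxevalD p q : mxeval A (p + q) = mxeval A p + mxeval A q.
Proof. by rewrite -[p]scale1r mxevalZD !scale1r. Qed.

Lemma mxevalZ c p : mxeval A (c *: p) = c *: mxeval A p.
Proof. by rewrite -[c *: p]addr0 mxevalZD mxeval0 addr0. Qed.

Lemma mxevalB p q : mxeval A (p - q) = mxeval A p - mxeval A q.
Proof. by rewrite addrC -scaleN1r mxevalZD scaleN1r addrC. Qed.

Lemma mxeval_sum (I : Type) (s : seq I) (P : pred I) (F : I -> {poly R}) :
  mxeval A (\sum_(i <- s | P i) F i) = \sum_(i <- s | P i) mxeval A (F i).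
Proof. exact: (big_morph _ mxevalD mxeval0). Qed.

Lemma mxeval_eigen m (v : 'M[R]_(n, m)) a p :
  A *m v = a *: v -> mxeval A p *m v = p.[a] *: v.
Proof.
move=> Av; elim/poly_ind: p => [|p c IHp].
  by rewrite mxeval0 mul0mx horner0 scale0r.
rewrite mxevalD mxevalM mxevalX mxevalC mulmxDl -mulmxA Av -scalemxAr IHp.
by rewrite mul_scalar_mx !hornerE scalerDl scalerA mulrC.
Qed.

End MxEval.

Lemma tr_mxeval (R : comNzRingType) n (A : 'M[R]_n) p :
  (mxeval A p)^T = mxeval A^T p.
Proof.
elim/poly_ind: p => [|p c IHp]; first by rewrite !mxeval0 trmx0.
rewrite [in LHS]mulrC !mxevalD linearD /= !mxevalC tr_scalar_mx !mxevalM.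
by rewrite trmx_mul IHp !mxevalX.
Qed.

(** * Real symmetric matrices *)

(** Over the complex closure [A] becomes Hermitian, hence unitarily
    diagonalizable with real diagonal; the diagonal entries are eigenvalues of
    [A] itself, so the product kills each of them.  It does so without
    multiplicities because [A] is diagonalizable. *)
Lemma symmetric_mxeval_roots (R : rcfType) n (A : 'M[R]_n) (th : seq R) :
  A^T = A -> (forall a, eigenvalue A a -> a \in th) ->
  mxeval A (\prod_(a <- th) ('X - a%:P)) = 0.
Proof.
case: n A => [A _ _|n A Asym Ath]; first exact: flatmx0.
set q := \prod_(a <- th) _; rewrite mxevalE.
pose f := real_complex R; pose B : 'M[R[i]]_n.+1 := map_mx f A.
have Bherm : B \is hermsymmx.
  apply: realsym_hermsym.
    apply/is_hermitianmxP; rewrite expr0 scale1r; apply/matrixP => i j.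
    by rewrite !mxE -{1}Asym mxE.
  by apply/mxOverP => i j; rewrite mxE; apply/complex_realP; exists (A i j).
have /orthomx_spectralP := hermitian_normalmx Bherm.
have /mxOverP := hermitian_spectral_diag_real Bherm.
have := spectral_unit B.
move: (spectral_diag B) (spectralmx B) => D P Pu Dreal BE.
apply/eqP; rewrite -(map_mx_eq0 f) map_horner_mx -/B BE horner_mx_uconjC //.
rewrite horner_mx_diag [map_mx _ D](_ : _ = 0) ?raddf0 ?mulmx0 ?mul0mx //.
apply/rowP => j; rewrite !mxE.
have /complex_realP[a Da] := Dreal 0 j.
rewrite Da -[X in horner _ X]/(f a) horner_map /=.
suff /Ath ath : eigenvalue A a.
  by apply/eqP; rewrite fmorph_eq0 -/(root _ _) root_prod_XsubC.
rewrite -(eigenvalue_map f) -/B; apply/eigenvalueP.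
exists (row j P).
  rewrite -row_mul BE !mulmxA mulmxV // mul1mx row_mul row_diag_mx -scalemxAl.
  by rewrite -rowE Da.
apply/eqP => Pj0; have /row_freeP[P' PP'] : row_free P by rewrite row_free_unit.
have /rowP/(_ j) : row j P *m P' = 0 by rewrite Pj0 mul0mx.
by rewrite -row_mul PP' !mxE eqxx; apply/eqP; rewrite oner_eq0.
Qed.

(** * Cauchy-Schwarz with its defect *)

(** The Cauchy-Schwarz inequality against the all-one vector, written as an
    identity so that its equality case can be read off. *)
Lemma sum_sqr_dev (R : realFieldType) (I : finType) (A : pred I) (f : I -> R) :
  \sum_(i in A) (f i - (\sum_(j in A) f j) / #|A|%:R) ^+ 2 =
  \sum_(i in A) f i ^+ 2 - (\sum_(i in A) f i) ^+ 2 / #|A|%:R.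
Proof.
set s := \sum_(j in A) f j; set k : R := #|A|%:R.
have -> : s ^+ 2 / k = 2 * (s / k) * s - (s / k) ^+ 2 * k.
  have [-> | k0] := eqVneq k 0; first by rewrite invr0; ring.
  by field.
rewrite {4}/k -sumr_const /s [X in _ = _ - (X - _)]mulr_sumr mulr_sumr.
rewrite -!sumrB; apply: eq_bigr => i _; ring.
Qed.

(** Row [x] of [m] has sum [s] and support in [A x]; the prescribed sum of all
    squares makes the row-wise Cauchy-Schwarz inequalities add up to a bound on
    [s] by the harmonic mean of the support sizes. *)
Section HarmonicMean.
Variables (R : realFieldType) (I : finType) (A : I -> pred I) (m : I -> I -> R).
Variable s : R.
Hypotheses (s0 : 0 < s) (I0 : (0 < #|I|)%N) (A0 : forall x, (0 < #|A x|)%N).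
Hypothesis m_supp : forall x y, y \notin A x -> m x y = 0.
Hypothesis m_row : forall x, \sum_y m x y = s.
Hypothesis m_sqr : \sum_x \sum_y m x y ^+ 2 = #|I|%:R * s.

Let S := \sum_x (#|A x|%:R)^-1 : R.

Let S0 : 0 < S.
Proof.
have [x _] := card_gt0P I0.
rewrite /S (bigD1 x) //= ltr_wpDr ?invr_gt0 ?ltr0n //.
by apply: sumr_ge0 => y _; rewrite invr_ge0 ler0n.
Qed.

(* The gap in the harmonic mean bound is the total Cauchy-Schwarz defect. *)
Let gap : s * (#|I|%:R - s * S) =
  \sum_x \sum_(y in A x) (m x y - s / #|A x|%:R) ^+ 2.
Proof.
have row x : \sum_(y in A x) m x y = s.
  rewrite -(m_row x) [RHS](bigID (mem (A x))) /= [X in _ + X]big1 ?addr0 //.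
  by move=> y; apply: m_supp.
transitivity (\sum_x \sum_y m x y ^+ 2 - s ^+ 2 * S).
  by rewrite m_sqr mulrBr [s * _%:R]mulrC mulrA expr2.
rewrite mulr_sumr -sumrB; apply: eq_bigr => x _.
have := sum_sqr_dev (A x) (m x); rewrite row => ->; congr (_ - _).
rewrite (bigID (mem (A x))) /= [X in _ + X]big1 ?addr0 // => y yA.
by rewrite m_supp // expr0n.
Qed.

Let gap_ge0 x : 0 <= \sum_(y in A x) (m x y - s / #|A x|%:R) ^+ 2.
Proof. by apply: sumr_ge0 => y _; apply: sqr_ge0. Qed.

Lemma harmonic_mean_ge : s <= #|I|%:R / S.
Proof.
rewrite ler_pdivlMr // -subr_ge0 -(pmulr_rge0 _ s0) gap.
exact: sumr_ge0.
Qed.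

(** Equality means that every row has zero Cauchy-Schwarz defect, that is, is
    constant on its support; the constant is dictated by the row sum. *)
Lemma harmonic_mean_eq :
  #|I|%:R / S = s <-> forall x y, y \in A x -> m x y = s / #|A x|%:R.
Proof.
have -> : #|I|%:R / S = s <->
    \sum_x \sum_(y in A x) (m x y - s / #|A x|%:R) ^+ 2 = 0.
  rewrite -gap; split=> [<-|/eqP].
    by rewrite divfK ?gt_eqF // subrr mulr0.
  rewrite mulf_eq0 gt_eqF //= subr_eq0 => /eqP->.
  by rewrite mulfK ?gt_eqF.
split=> [/eqP|mE]; last first.
  by rewrite big1 // => x _; rewrite big1 // => y /mE->; rewrite subrr expr0n.
rewrite psumr_eq0 // => /allP sq0 x y yA; have := sq0 x (mem_index_enum _).
rewrite psumr_eq0 => [/allP/(_ y (mem_index_enum _))|z _]; last exact: sqr_ge0.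
by rewrite yA sqrf_eq0 subr_eq0 => /eqP.
Qed.

End HarmonicMean.

(** * The Laplacian matrix of a connected graph *)

Section Laplacian.
Variables (R : rcfType) (X : finType) (e : rel X).
Hypothesis (he : simple_graph e).
Local Notation L := (laplacian_mx R e).
Local Notation v := (@enum_val X X).

Lemma laplacianE i j : L i j =
  (if v i == v j then (degree e (v i))%:R else 0) - (e (v i) (v j))%:R.
Proof. by rewrite !mxE. Qed.

Lemma tr_laplacian : L^T = L.
Proof.
apply/matrixP => i j; rewrite mxE !laplacianE he.1 eq_sym.
by case: eqP => // ->.
Qed.

Lemma degreeE x : (degree e x)%:R = \sum_y (e x y)%:R :> R.
Proof.
rewrite /degree -sum1_card natr_sum big_mkcond.
by apply: eq_bigr => y _; rewrite inE; case: (e x y).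
Qed.

Lemma mul_laplacianE (u : 'cV[R]_#|X|) (g : X -> R) i :
  (forall j, u j 0 = g (v j)) ->
  (L *m u) i 0 = \sum_y (e (v i) y)%:R * (g (v i) - g y).
Proof.
move=> ug; rewrite mxE.
transitivity (\sum_(y in X) ((if v i == y then (degree e (v i))%:R else 0)
   - (e (v i) y)%:R) * g y).
  by rewrite [RHS]big_enum_val; apply: eq_bigr => j _; rewrite laplacianE ug.
under eq_bigr do rewrite mulrBl.
under [RHS]eq_bigr do rewrite mulrBr.
rewrite !sumrB -mulr_suml -degreeE; congr (_ - _).
rewrite (bigD1 (v i)) //= eqxx big1 ?addr0 // => y /negPf.
by rewrite eq_sym => ->; rewrite mul0r.
Qed.

Lemma laplacian_const : L *m const_mx 1 = 0 :> 'cV_#|X|.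
Proof.
apply/colP => i; rewrite (@mul_laplacianE _ (fun=> 1)) ?mxE.
  by rewrite big1 // => y _; rewrite subrr mulr0.
by move=> j; rewrite mxE.
Qed.

Lemma mxeval_laplacian_const m p :
  mxeval L p *m const_mx 1 = p.[0] *: const_mx 1 :> 'M_(#|X|, m).
Proof.
apply: mxeval_eigen; rewrite scale0r.
rewrite (_ : const_mx 1 = (const_mx 1 : 'cV_#|X|) *m (const_mx 1 : 'rV_m)).
  by rewrite mulmxA laplacian_const mul0mx.
by apply/matrixP => i j; rewrite !mxE big_ord1 !mxE mulr1.
Qed.

(** Symmetrizing the sum over ordered pairs turns the quadratic form of the
    Laplacian into a sum of squares over edges, which is what makes its kernel
    accessible. *)
Lemma laplacian_quadratic (g : X -> R) :
  \sum_x \sum_y (e x y)%:R * (g x - g y) ^+ 2 =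
  2 * \sum_x g x * \sum_y (e x y)%:R * (g x - g y).
Proof.
transitivity (\sum_x \sum_y (g x * ((e x y)%:R * (g x - g y)))
  + \sum_x \sum_y (g y * ((e y x)%:R * (g y - g x)))).
  rewrite -big_split; apply: eq_bigr => x _.
  rewrite -big_split; apply: eq_bigr => y _ /=; rewrite [e y x]he.1; ring.
rewrite [X in _ + X]exchange_big /= -mulr2n mulr_natl.
by congr (_ *+ 2); apply: eq_bigr => x _; rewrite mulr_sumr.
Qed.

Lemma edge_invariant_const (T : Type) (g : X -> T) x y :
  (forall x y, e x y -> g x = g y) -> connect e x y -> g x = g y.
Proof.
move=> ge /connectP[p pp ->] {y}.
by elim: p x pp => //= z p IHp x /andP[/ge -> /IHp].
Qed.

(** A vector in the kernel annuls the quadratic form, so it takes equal values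
    at the ends of each edge, and connectivity propagates this. *)
Lemma laplacian_ker (u : 'cV[R]_#|X|) :
  connected_graph e -> L *m u = 0 -> forall i j, u i 0 = u j 0.
Proof.
move=> hconn Lu; pose g x := u (enum_rank x) 0.
have ug j : u j 0 = g (v j) by rewrite /g enum_valK.
have Lg x : \sum_y (e x y)%:R * (g x - g y) = 0.
  by rewrite -[x]enum_rankK -(mul_laplacianE _ ug) Lu mxE.
move=> i j; rewrite !ug; apply: edge_invariant_const (hconn _ _) => x y exy.
have := laplacian_quadratic g; rewrite [in RHS]big1 ?mulr0; last first.
  by move=> z _; rewrite Lg mulr0.
have ge0 a b : 0 <= (e a b)%:R * (g a - g b) ^+ 2.
  by rewrite mulr_ge0 ?ler0n ?sqr_ge0.
move/eqP; rewrite psumr_eq0 => [/allP/(_ x (mem_index_enum _))|z _]; last first.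
  by apply: sumr_ge0.
rewrite psumr_eq0 // => /allP/(_ y (mem_index_enum _)).
by rewrite exy mul1r sqrf_eq0 subr_eq0 => /eqP.
Qed.

(** A nonzero entry of a power of [L] comes from a walk that at each step stays
    put or follows an edge. *)
Lemma laplacian_power_support k i j :
  (L ^+ k) i j != 0 -> (gdist e (v i) (v j) <= k)%N.
Proof.
move=> Lij; suff [p [pp <- sp]] : exists p,
    [/\ path e (v i) p, last (v i) p = v j & (size p <= k)%N].
  by apply: leq_trans sp; exact: gdist_le.
elim: k i j Lij => [|k IHk] i j.
  rewrite expr0 mxE; have [-> _|_] := eqVneq i j; last by rewrite eqxx.
  by exists [::].
rewrite exprS mxE => Lij.
have [l] : exists l, L i l * (L ^+ k) l j != 0.
  apply/existsP; apply: contraR Lij; rewrite negb_exists => /forallP Lij.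
  by rewrite big1 // => l _; apply/eqP; have := Lij l; rewrite negbK.
rewrite mulf_eq0 negb_or laplacianE => /andP[Lil /IHk [p [pp lp sp]]].
move: Lil; have [/enum_val_inj -> _|_] := eqVneq (v i) (v l).
  by exists p; split; rewrite ?leqW.
rewrite sub0r oppr_eq0 pnatr_eq0 eqb0 negbK => eil.
by exists (v l :: p); rewrite /= eil.
Qed.

Lemma mxeval_laplacian_far (p : {poly R}) i j :
  (size p <= gdist e (v i) (v j))%N -> mxeval L p i j = 0.
Proof.
move=> sp; rewrite summxE big1 // => k _; rewrite mxE.
have [->|/laplacian_power_support] := eqVneq ((L ^+ k) i j) 0.
  by rewrite mulr0.
by rewrite leqNgt (leq_trans (ltn_ord k)).
Qed.

Lemma tr_mxeval_laplacian p : (mxeval L p)^T = mxeval L p.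
Proof. by rewrite tr_mxeval tr_laplacian. Qed.

(** Existence of the Hoffman polynomial: what remains of the annihilating
    product after removing the factor of the eigenvalue [0]. *)
Lemma laplacian_hoffman (th : seq R) : (0 < #|X|)%N -> connected_graph e ->
  laplacian_spectrum e th ->
  exists2 h : {poly R}, (size h <= size th)%N & mxeval L h = const_mx 1.
Proof.
move=> X0 hconn [/lt_sorted_uniq uth thE].
have i0 : 'I_#|X| by exact: Ordinal X0.
have th0 : 0 \in th.
  rewrite thE; apply/eigenvalueP; exists (const_mx 1).
    rewrite scale0r -[L]trmxK tr_laplacian -trmx_const -trmx_mul.
    by rewrite laplacian_const trmx0.
  by apply/eqP => /rowP/(_ i0); rewrite !mxE; apply/eqP; rewrite oner_eq0.
pose q : {poly R} := \prod_(a <- th | a != 0) ('X - a%:P).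
have qE : \prod_(a <- th) ('X - a%:P) = q * 'X.
  by rewrite (bigD1_seq 0) //= subr0 mulrC.
have q0 : q.[0] != 0.
  rewrite horner_prod prodf_seq_neq0; apply/allP => a _; apply/implyP => a0.
  by rewrite !hornerE oppr_eq0.
have qn0 : q != 0 by apply: contraNneq q0 => ->; rewrite horner0.
have szq : size q = size th.
  by apply: succn_inj; rewrite -(size_mulX qn0) -qE size_prod_XsubC.
pose B := mxeval L q.
have LB : L *m B = 0.
  rewrite -[L in L *m _]mxevalX -mxevalM mulrC -qE.
  by apply: symmetric_mxeval_roots tr_laplacian _ => a; rewrite thE.
(* Columns of B are constant, being in the kernel of L; symmetry then makes B
   constant altogether. *)
have Bcol i i' j : B i j = B i' j.
  have Lcol : L *m col j B = 0 by rewrite colE mulmxA LB mul0mx.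
  by have := laplacian_ker hconn Lcol i i'; rewrite !mxE.
have BE : B = const_mx (B i0 i0).
  apply/matrixP => i j; rewrite mxE (Bcol i i0) -[B in LHS]tr_mxeval_laplacian.
  by rewrite mxE.
(* The row sums of B are q.[0], the product of the nonzero -theta_i. *)
have B0 : B i0 i0 != 0.
  apply: contraNneq q0 => B0; have := mxeval_laplacian_const 1 q.
  rewrite -/B BE B0 mul0mx => /colP/(_ i0); rewrite !mxE mulr1.
  by move=> <-.
exists ((B i0 i0)^-1 *: q); first by rewrite size_scale ?invr_eq0 ?szq.
rewrite mxevalZ -/B BE; apply/matrixP => i j.
by rewrite !mxE mulVf.
Qed.

End Laplacian.

(** * The trace form and the predistance polynomials *)

(** A sequence with exactly one polynomial of each size up to [k] spans the
    polynomials of size at most [k]; stated as an induction principle for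
    predicates that are closed under linear combinations. *)
Lemma size_triangular_ind (F : fieldType) (P : {poly F} -> Prop)
  (r : nat -> {poly F}) k :
  P 0 -> (forall c p q, P p -> P q -> P (c *: p + q)) ->
  (forall i, (i < k)%N -> size (r i) = i.+1 /\ P (r i)) ->
  forall f : {poly F}, (size f <= k)%N -> P f.
Proof.
move=> P0 PZD; elim: k => [|k IHk] rP f.
  by rewrite leqn0 size_poly_eq0 => /eqP->.
move=> szf; have [szr Pr] := rP k (ltnSn k).
pose c := f`_k / (r k)`_k; rewrite -(subrK (c *: r k) f) addrC.
apply: (PZD _ _ _ Pr); apply: IHk => [i ik|]; first by apply/rP/leqW.
have rk0 : (r k)`_k != 0.
  have := lead_coef_eq0 (r k).
  by rewrite lead_coefE szr -size_poly_eq0 szr => ->.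
apply/leq_sizeP => j; rewrite leq_eqVlt coefB coefZ => /predU1P[<-|kj].
  by rewrite /c divfK ?subrr.
by rewrite !nth_default ?szr ?mulr0 ?subrr // (leq_trans szf).
Qed.

Lemma trace_sqr_symmetric (R : comNzRingType) n (A : 'M[R]_n) :
  A^T = A -> \tr (A *m A) = \sum_i \sum_j A i j ^+ 2.
Proof.
move=> Asym; apply: eq_bigr => i _; rewrite mxE; apply: eq_bigr => j _.
by rewrite -[in A j i]Asym mxE expr2.
Qed.

Section LapDot.
Variables (R : rcfType) (X : finType) (e : rel X).
Hypothesis (he : simple_graph e) (X0 : (0 < #|X|)%N).
Local Notation L := (laplacian_mx R e).
Local Notation dot := (@lap_dot R X e).

Let n0 : #|X|%:R != 0 :> R.
Proof. by rewrite pnatr_eq0 -lt0n. Qed.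

Lemma lap_dotE f g : dot f g = #|X|%:R^-1 * \tr (mxeval L (f * g)).
Proof. by rewrite mxevalM. Qed.

Lemma lap_dotC f g : dot f g = dot g f.
Proof. by rewrite !lap_dotE [f * g]mulrC. Qed.

Lemma lap_dotZDl c f g h : dot (c *: f + g) h = c * dot f h + dot g h.
Proof.
rewrite !lap_dotE mulrDl -scalerAl mxevalZD mxtraceD mxtraceZ; ring.
Qed.

Lemma lap_dot0l h : dot 0 h = 0.
Proof. by rewrite lap_dotE mul0r mxeval0 mxtrace0 mulr0. Qed.

Lemma lap_dot_suml (s : seq nat) (F : nat -> {poly R}) h :
  dot (\sum_(i <- s) F i) h = \sum_(i <- s) dot (F i) h.
Proof.
elim: s => [|i s IHs]; first by rewrite !big_nil lap_dot0l.
by rewrite !big_cons -[F i in LHS]scale1r lap_dotZDl mul1r IHs.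
Qed.

Lemma lap_dot_frobenius f :
  dot f f = #|X|%:R^-1 * \sum_i \sum_j mxeval L f i j ^+ 2.
Proof. by rewrite -trace_sqr_symmetric ?tr_mxeval_laplacian. Qed.

Lemma lap_dot_ge0 f : 0 <= dot f f.
Proof.
rewrite lap_dot_frobenius mulr_ge0 ?invr_ge0 ?ler0n //.
by apply: sumr_ge0 => i _; apply: sumr_ge0 => j _; apply: sqr_ge0.
Qed.

(** The form is definite only modulo the minimal polynomial of [L]. *)
Lemma lap_dot_eq0 f : dot f f = 0 -> mxeval L f = 0.
Proof.
move/eqP; rewrite lap_dot_frobenius mulf_eq0 invr_eq0 (negPf n0) /=.
rewrite psumr_eq0 => [/allP f0|i _]; last first.
  by apply: sumr_ge0 => j _; apply: sqr_ge0.
apply/matrixP => i j; have := f0 i (mem_index_enum _).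
rewrite psumr_eq0 => [/allP/(_ j (mem_index_enum _))|k _]; last exact: sqr_ge0.
by rewrite sqrf_eq0 mxE => /eqP.
Qed.

(** A polynomial with value [J] at [L] represents evaluation at [0], because
    [J f(L) = f(0) J]. *)
Lemma lap_dot_hoffman h f : mxeval L h = const_mx 1 -> dot h f = f.[0].
Proof.
move=> hJ; rewrite lap_dotC lap_dotE mxevalM hJ mxeval_laplacian_const //.
rewrite mxtraceZ /mxtrace; under eq_bigr do rewrite mxE.
by rewrite sumr_const card_ord mulrCA mulVf ?mulr1.
Qed.

Variables (d : nat) (r : nat -> {poly R}).
Hypothesis (hr : laplacian_predistance e d r).

(** Orthogonality and the normalization [<r_j, r_j> = r_j(0)] say that partial
    sums also represent evaluation at [0], on the span of their terms. *)
Lemma lap_dot_partial_sum k j : (j < k)%N -> (k <= d.+1)%N ->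
  dot (\sum_(0 <= i < k) r i) (r j) = (r j).[0].
Proof.
case: hr => _ orth nrm jk kd; have jd : (j <= d)%N by apply: leq_trans jk kd.
rewrite lap_dot_suml (bigD1_seq j) ?iota_uniq ?mem_index_iota //= nrm //.
rewrite big_seq_cond big1 ?addr0 // => i /andP[].
rewrite mem_index_iota => /= ik.
by apply: orth => //; apply: leq_trans ik kd.
Qed.

Lemma lap_dot_partial_sum_self k : (k <= d.+1)%N ->
  let s := \sum_(0 <= i < k) r i in dot s s = s.[0].
Proof.
move=> kd s; rewrite {1}/s lap_dot_suml horner_sum.
rewrite !big_nat; apply: eq_bigr => i ik.
by rewrite lap_dotC lap_dot_partial_sum.
Qed.

Lemma size_predistance_sum k : (k <= d.+1)%N ->
  (size (\sum_(0 <= i < k) r i)%R <= k)%N.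
Proof.
case: hr => szr _ _ kd; apply: leq_trans (size_sum _ _ _) _.
apply/bigmax_leqP_seq => i; rewrite mem_index_iota => /= ik _.
by rewrite szr // -ltnS (leq_trans ik).
Qed.

(** Both the full sum and a Hoffman polynomial represent evaluation at [0] on
    polynomials of degree at most [d], so their difference is orthogonal to
    itself. *)
Lemma predistance_sum_hoffman (th : seq R) : connected_graph e ->
  laplacian_spectrum e th -> size th = d.+1 ->
  mxeval L (\sum_(0 <= i < d.+1) r i) = const_mx 1.
Proof.
move=> hconn hth szth; have [h szh hJ] := laplacian_hoffman he X0 hconn hth.
set H := \sum_(0 <= i < _) _; apply/eqP; rewrite -subr_eq0 -hJ -mxevalB.
apply/eqP/lap_dot_eq0.
have [szr _ _] := hr.
apply: (@size_triangular_ind _ (fun f => dot f (H - h) = 0) r d.+1).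
- exact: lap_dot0l.
- by move=> c p q p0 q0; rewrite lap_dotZDl p0 q0 mulr0 addr0.
- move=> i id; split; first exact: szr.
  rewrite lap_dotC addrC -scaleN1r lap_dotZDl lap_dot_hoffman //.
  by rewrite lap_dot_partial_sum // mulN1r addNr.
rewrite (leq_trans (size_polyD _ _)) // size_polyN geq_max -szth szh andbT szth.
exact: size_predistance_sum.
Qed.

Lemma predistance0 : r 0 = 1.
Proof.
case: hr => /(_ 0%N isT) sz _ /(_ 0%N isT).
have /size_poly1P[c c0 ->] : size (r 0) == 1%N by rewrite sz.
rewrite lap_dotE -polyCM mxevalC mxtrace_scalar hornerC => cc.
suff -> : c = 1 by [].
by apply: (mulfI c0); rewrite mulr1 -[RHS]cc -[X in _ = _ * X]mulr_natl mulKf.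
Qed.

Lemma predistance_at0_ge0 i : (i <= d)%N -> 0 <= (r i).[0].
Proof. by case: hr => _ _ nrm id; rewrite -nrm ?lap_dot_ge0. Qed.

End LapDot.

(** * Distances and the diameter *)

Section Diameter.
Variables (X : finType) (e : rel X).
Hypothesis hconn : connected_graph e.

Lemma gdist_eq0 x y : (gdist e x y == 0%N) = (x == y).
Proof.
apply/eqP/eqP => [d0|->]; last first.
  by apply/eqP; rewrite -leqn0 (@gdist_le _ e y [::]).
have := walk_gdist (hconn x y).
by rewrite d0 => /walkP[p [_ <- /size0nil->]].
Qed.

Lemma gdist_edge x y : e x y -> (gdist e x y <= 1)%N.
Proof. by move=> exy; apply: (@gdist_le _ e x [:: y]); rewrite /= exy. Qed.

Lemma gdist_le_diameter x y : (gdist e x y <= diameter e)%N.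
Proof.
by apply: leq_trans (leq_bigmax x); apply: (leq_bigmax y).
Qed.

Lemma diameter_attained : (0 < #|X|)%N -> exists x y, gdist e x y = diameter e.
Proof.
move=> X0; have [x xE] := bigop.eq_bigmax (fun x => \max_y gdist e x y) X0.
by have [y yE] := bigop.eq_bigmax (gdist e x) X0; exists x, y; rewrite -yE -xE.
Qed.

Lemma diameter_gt0 : (1 < #|X|)%N -> (0 < diameter e)%N.
Proof.
case/card_gt1P => x [y [_ _ xy]]; apply: leq_trans (gdist_le_diameter x y).
by rewrite lt0n gdist_eq0.
Qed.

End Diameter.

(** * The partial sum below the diameter *)

Section BelowDiameter.
Variables (R : rcfType) (X : finType) (e : rel X) (d : nat).
Variables (r : nat -> {poly R}).
Hypotheses (hX : (1 < #|X|)%N) (he : simple_graph e).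
Hypotheses (hconn : connected_graph e) (hr : laplacian_predistance e d r).

Local Notation D := (diameter e).
Local Notation L := (laplacian_mx R e).
Local Notation n := (#|X|%:R : R).
Let H : {poly R} := \sum_(0 <= i < d.+1) r i.
Let s : {poly R} := \sum_(0 <= i < D) r i.

Hypothesis HJ : mxeval L H = const_mx 1.

Let X0 : (0 < #|X|)%N. Proof. exact: ltnW. Qed.
Let n0 : n != 0. Proof. by rewrite pnatr_eq0 -lt0n. Qed.
Let D0 : (0 < D)%N. Proof. exact: diameter_gt0. Qed.

Let sum_row p (i : 'I_#|X|) : \sum_j mxeval L p i j = p.[0].
Proof.
have /colP/(_ i) := mxeval_laplacian_const e 1 p.
by rewrite !mxE mulr1 => <-; apply: eq_bigr => j _; rewrite mxE mulr1.
Qed.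

Let H0 : H.[0] = n.
Proof.
rewrite -(sum_row H (Ordinal X0)) HJ; under eq_bigr do rewrite mxE.
by rewrite sumr_const card_ord.
Qed.

(** Otherwise [H], of degree at most [d], would vanish at [L] on a pair of
    vertices at distance [D]; but [J] has no zero entry. *)
Lemma diameter_le_predistance_degree : (D <= d)%N.
Proof.
rewrite leqNgt; apply/negP => dD; have [x [y xy]] := diameter_attained e X0.
have szH : (size H <= gdist e x y)%N.
  by rewrite xy (leq_trans (size_predistance_sum hr _)).
have := @mxeval_laplacian_far R X e H (enum_rank x) (enum_rank y).
by rewrite !enum_rankK HJ mxE => /(_ szH)/eqP; rewrite oner_eq0.
Qed.

Let Dd := diameter_le_predistance_degree.

Let HE : H = s + \sum_(D <= i < d.+1) r i.
Proof. by rewrite /H (@big_cat_nat _ _ _ D) // leqW. Qed.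

Lemma below_diameter_at0 : s.[0] = n - \sum_(D <= i < d.+1) (r i).[0].
Proof. by rewrite -H0 HE hornerD [X in _ + X - _]horner_sum addrK. Qed.

Lemma above_diameter_mxeval :
  \sum_(D <= i < d.+1) mxeval L (r i) = const_mx 1 - mxeval L s.
Proof. by rewrite -mxeval_sum -HJ HE mxevalD addrC addKr. Qed.

Let s0 : 0 < s.[0].
Proof.
rewrite /s big_ltn // hornerD (predistance0 X0 hr) hornerC horner_sum.
rewrite ltr_pwDl ?ltr01 // big_nat; apply: sumr_ge0 => i /andP[_ iD].
by apply: (predistance_at0_ge0 he hr); rewrite (leq_trans (ltnW iD)).
Qed.

(* [A x] leaves out Gamma_D(x), where row [x] of s(L) vanishes by degree. *)
Let m x y : R := mxeval L s (enum_rank x) (enum_rank y).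
Let A x : pred X := [pred y | gdist e x y != D].

Let card_support x : #|A x|%:R = n - #|sphere e D x|%:R.
Proof.
rewrite -(cardC (mem (sphere e D x))) natrD addrC addKr; congr (_%:R).
by apply: eq_card => y; rewrite !inE.
Qed.

Let support_refl x : x \in A x.
Proof.
rewrite inE; have /eqP-> : gdist e x x == 0%N by rewrite gdist_eq0.
by rewrite neq_ltn D0.
Qed.

Let support_gt0 x : (0 < #|A x|)%N.
Proof. by apply/card_gt0P; exists x. Qed.

Let m_supp x y : y \notin A x -> m x y = 0.
Proof.
rewrite inE negbK => /eqP xy; apply: mxeval_laplacian_far.
by rewrite !enum_rankK xy (size_predistance_sum hr) // leqW.
Qed.

Let sum_rank (F : 'I_#|X| -> R) : \sum_i F i = \sum_x F (enum_rank x).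
Proof. by apply: reindex; apply: onW_bij; apply: enum_rank_bij. Qed.

Let m_row x : \sum_y m x y = s.[0].
Proof. by rewrite -(sum_row s (enum_rank x)) sum_rank. Qed.

Let m_sqr : \sum_x \sum_y m x y ^+ 2 = n * s.[0].
Proof.
have <- : lap_dot e s s = s.[0].
  by apply: (lap_dot_partial_sum_self hr); rewrite leqW.
rewrite lap_dot_frobenius // mulrA divff // mul1r sum_rank.
by apply: eq_bigr => x _; rewrite sum_rank.
Qed.

Let m_sym x y : m x y = m y x.
Proof. by rewrite /m -{1}(tr_mxeval_laplacian he) mxE. Qed.

(* The trace of s(L) is n <s, r_0> since r_0 = 1. *)
Let m_tr : \sum_x m x x = n.
Proof.
have := lap_dot_partial_sum hr D0 (leqW Dd).
rewrite (predistance0 X0 hr) hornerC lap_dotE // mulr1 /mxtrace sum_rank.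
by move=> /(congr1 ( *%R n)); rewrite mulrA divff // mul1r mulr1.
Qed.

Let hmean : R := n / \sum_(x : X) (n - #|sphere e D x|%:R)^-1.

Let hmeanE : hmean = n / \sum_x (#|A x|%:R)^-1.
Proof. by congr (_ / _); apply: eq_bigr => x _; rewrite card_support. Qed.

Lemma below_diameter_le_hmean : s.[0] <= hmean.
Proof.
rewrite hmeanE.
exact: (harmonic_mean_ge s0 X0 support_gt0 m_supp m_row m_sqr).
Qed.

(** The row constants are the diagonal entries, as each vertex lies in its own
    support.  For an edge [ab] with [D >= 2] both [m a b] and [m b a] are such
    constants, so symmetry of [m] spreads one value over the graph; for [D = 1]
    the matrix is [r_0(L) = I].  The trace fixes the value to [1]. *)
Lemma equality_entries :
  hmean = s.[0] <-> forall x y, m x y = (y \in A x)%:R.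
Proof.
rewrite hmeanE (harmonic_mean_eq s0 X0 support_gt0 m_supp m_row m_sqr).
split=> [mE x y|mE x y yA]; last first.
  have -> : s.[0] = #|A x|%:R.
    rewrite -(m_row x) -sum1_card natr_sum [RHS]big_mkcond /=.
    by apply: eq_bigr => z _; rewrite mE; case: (z \in A x).
  by rewrite mE yA divff // pnatr_eq0 -lt0n.
have [yA|/m_supp//] := boolP (y \in A x).
have diag_const a b : m a a = m b b.
  have [D2|] := leqP 2 D.
    apply: (edge_invariant_const (g := fun z => m z z)) (hconn a b).
    move=> {a b}a b eab.
    have edgeA u v : e u v -> v \in A u.
      by move=> /gdist_edge uv; rewrite inE neq_ltn (leq_ltn_trans uv).
    rewrite (mE a a) // -(mE a b) ?edgeA // m_sym (mE b a) ?(mE b b) //.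
    by rewrite edgeA // he.1.
  rewrite ltnS => D1; have D1E : D = 1%N by apply/eqP; rewrite eqn_leq D1.
  by rewrite /m /s D1E big_nat1 (predistance0 X0 hr) mxevalC !mxE !eqxx.
rewrite (mE x y) // -(mE x x) //.
have := m_tr; under eq_bigr do rewrite (diag_const _ x).
by rewrite sumr_const => nm; apply: (mulfI n0); rewrite mulr_natl nm mulr1.
Qed.

Lemma equality_distance_mx :
  hmean = s.[0] <->
  distance_mx R e D = \sum_(D <= i < d.+1) mxeval L (r i).
Proof.
rewrite equality_entries above_diameter_mxeval; split=> [mE|DE x y].
  apply/matrixP => i j; rewrite !mxE.
  have := mE (enum_val i) (enum_val j); rewrite /m !enum_valK => ->.
  by rewrite inE; case: eqP; rewrite ?subr0 ?subrr.
have /matrixP/(_ (enum_rank x) (enum_rank y)) := DE.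
rewrite !mxE !enum_rankK -/(m x y) inE => /eqP.
rewrite eq_sym subr_eq addrC -subr_eq => /eqP <-.
by case: eqP; rewrite ?subr0 ?subrr.
Qed.

(** On the diagonal, [r_0(L) + r_1(L)] is a nonconstant affine function of the
    degree. *)
Lemma equality_regular : hmean = s.[0] -> D = 2%N -> regular_graph e.
Proof.
move=> /equality_entries mE D2.
have sz1 : size (r 1) = 2%N.
  by have [szr _ _] := hr; rewrite szr // (leq_trans _ Dd) ?D2.
have [a [b [a0 r1E]]] : exists a b, a != 0 /\ r 1 = a *: 'X + b%:P.
  exists (r 1)`_1, (r 1)`_0; split.
    have := lead_coef_eq0 (r 1).
    by rewrite lead_coefE sz1 -size_poly_eq0 sz1 => ->.
  rewrite -[LHS]coefK sz1 poly_def !big_ord_recl big_ord0 /= addr0 expr0 expr1.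
  by rewrite addrC alg_polyC.
have deg x : (degree e x)%:R = - b / a.
  have := mE x x; rewrite support_refl /m /s D2 big_nat_recl // big_nat1.
  rewrite (predistance0 X0 hr) r1E !mxevalD mxevalZ mxevalX !mxevalC !mxE.
  rewrite !eqxx /= !mulr1n enum_rankK he.2 subr0.
  move=> /eqP; rewrite -subr_eq0 addrAC subrr add0r addr_eq0 => /eqP <-.
  by rewrite mulrC mulKf.
have [x0 _] := card_gt0P X0.
by exists (degree e x0) => x; apply/eqP; rewrite -(eqr_nat R) !deg.
Qed.

End BelowDiameter.

(** * Conclusion *)

Theorem theorem3p1 (R : rcfType) (X : finType) (e : rel X)
  (theta : seq R) (d : nat) (r : nat -> {poly R})
  (hX : (2 <= #|X|)%N) (he : simple_graph e) (hconn : connected_graph e)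
  (htheta : laplacian_spectrum e theta) (hd : size theta = d.+1)
  (hr : laplacian_predistance e d r) :
  let D := diameter e in
  let L := laplacian_mx R e in
  let n : R := #|X|%:R in
  let s : {poly R} := \sum_(0 <= i < D) r i in
  let hmean : R := n / \sum_(x : X) (n - #|sphere e D x|%:R)^-1 in
  [/\ hmean >= s.[0],
      s.[0] = n - \sum_(D <= i < d.+1) (r i).[0],
      hmean = s.[0] <->
        distance_mx R e D = \sum_(D <= i < d.+1) mxeval L (r i)
    & hmean = s.[0] -> D = 2%N -> regular_graph e].
Proof.
move=> D L n s hmean.
have HJ := predistance_sum_hoffman he (ltnW hX) hr hconn htheta hd.
split.
- exact: (below_diameter_le_hmean hX he hconn hr HJ).
- exact: (below_diameter_at0 hX hr HJ).
- exact: (equality_distance_mx hX he hconn hr HJ).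
- exact: (equality_regular hX he hconn hr HJ).
Qed.
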